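(* Let $(C_{12},\Gamma_{12}):O_1\to O_2$ be a cylinder that is a morphism in $\mathrm{Bord}_2^{\mathrm{def,cw}}(\mathcal{D}_+^{\mathbf 3})$, and let $O_t$ be a generic cross-section of $(C_{12},\Gamma_{12})$ which decomposes it as a composite of bordisms $$O_1\xrightarrow{(C_{1t},\Gamma_{1t})}O_t\xrightarrow{(C_{t2},\Gamma_{t2})}O_2 .$$ For a cylinder $(C_{xy},\Gamma_{xy}):x\to y$ and fixed colorings $\hat x$ of the in-boundary $x$ and $\hat y$ of the out-boundary $y$, let $\#\mathrm{Tait}_{\hat x,\hat y}\Gamma_{xy}$ be the number of $3$-edge colorings of $\Gamma_{xy}$ that restrict to $\hat x$ on $x$ and to $\hat y$ on $y$. Then for all colorings $\hat O_1$ of $O_1$ and $\hat O_2$ of $O_2$, $$\#\mathrm{Tait}_{\hat O_1,\hat O_2}\Gamma_{12}=\sum_{\hat O_t}\big(\#\mathrm{Tait}_{\hat O_1,\hat O_t}\Gamma_{1t}\big)\big(\#\mathrm{Tait}_{\hat O_t,\hat O_2}\Gamma_{t2}\big),$$ where the sum runs over all colorings $\hat O_t$ of $O_t$.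
   Context: A cylinder $(C,\Gamma):O\to O'$ in $\mathrm{Bord}_2^{\mathrm{def,cw}}(\mathcal{D}_+^{\mathbf 3})$ is an oriented cylinder $C\cong\mathbb{S}^1\times[0,1]$ with in-boundary circle $O$ and out-boundary circle $O'$, together with an embedded undirected graph $\Gamma\subset C$ whose vertices are all trivalent and lie in the interior of $C$, whose edges are transverse to $\partial C$, and which meets $\partial C$ in finitely many marked points (the marked points of $O$ and $O'$). (It also carries a compatible PLCW decomposition, which plays no role here.) Edges of $\Gamma$ may end on $\partial C$, and components of $\Gamma$ without vertices are allowed. A coloring of a circle with marked points is an arbitrary assignment of an element of $\{a,b,c\}$ to each marked point. A $3$-edge coloring (Tait-coloring) of $\Gamma$ is an assignment of an element of $\{a,b,c\}$ to each edge such that at every vertex the three incident (half-)edges receive three different elements; its restriction to a boundary circle (or cross-section) gives each marked point the color of the edge through it. A generic cross-section is a circle $O_t$, a level set of a height function on $C_{12}$, separating $O_1$ from $O_2$, having a neighbourhood that is, as a stratified surface, a product $O_t\times(-\epsilon,\epsilon)$; in particular it contains no vertex of $\Gamma_{12}$ and is transverse to its edges. Its marked points are its intersections with $\Gamma_{12}$, and $\Gamma_{1t},\Gamma_{t2}$ are the parts of $\Gamma_{12}$ in the two cylinders $C_{1t},C_{t2}$ into which $O_t$ cuts $C_{12}$. *)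

(* Defs.v *)
From HB Require Import structures.
From mathcomp Require Import all_boot all_order all_algebra finmap.
From mathcomp Require Import all_classical all_reals all_analysis.

Set Implicit Arguments.
Unset Strict Implicit.
Unset Printing Implicit Defensive.

Import Order.TTheory GRing.Theory Num.Theory.
Import numFieldNormedType.Exports.

Local Open Scope classical_set_scope.
Local Open Scope ring_scope.

(* f : A -> B and g : B -> A are mutually inverse homeomorphisms for the
   subspace topologies; their values off A and B are irrelevant. *)
Definition homeo_on (T U : topologicalType) (A : set T) (B : set U)
    (f : T -> U) (g : U -> T) : Prop :=
  [/\ set_fun A B f, set_fun B A g,
      {in A, cancel f g}, {in B, cancel g f} &
      {within A, continuous f} /\ {within B, continuous g}].

Definition open_in (T : topologicalType) (A U : set T) : Prop :=
  exists2 W : set T, open W & U = A `&` W.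

Record marked_circle (T : topologicalType) := MarkedCircle {
  circ : set T;
  marks : set T }.

(* Underlying data of a morphism src -> tgt whose surface lies in the ambient
   space T (which may be the surface itself). The geometric conditions are
   imposed by [is_cylinder]. *)
Record bordism (T : topologicalType) := Bordism {
  src : marked_circle T;
  tgt : marked_circle T;
  surf : set T;
  graph : set T;
  verts : set T }.

Definition bdry (T : topologicalType) (X : bordism T) : set T :=
  circ (src X) `|` circ (tgt X).

Section LocalModels.
Variable R : realType.

Definition unit_circle : set (R * R) := [set p | p.1 ^+ 2 + p.2 ^+ 2 = 1].

(* The open square, homeomorphic to an open disc. *)
Definition square : set (R * R) := `]-1, 1[ `*` `]-1, 1[.
Definition vertical_line : set (R * R) := [set 0] `*` `]-1, 1[.

Definition half_square : set (R * R) := `]-1, 1[ `*` `[0, 1[.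
Definition half_square_bdry : set (R * R) := `]-1, 1[ `*` [set 0].
Definition vertical_ray : set (R * R) := [set 0] `*` `[0, 1[.

Definition leg_dir (i : 'I_3) : R * R :=
  nth (0, 0) [:: (1, 0); (0, 1); (-1, -1)] i.
Definition leg (i : 'I_3) : set (R * R) :=
  [set (s * (leg_dir i).1, s * (leg_dir i).2) | s in `]0, 1[].
Definition tripod : set (R * R) := [set (0, 0)] `|` \bigcup_i leg i.

End LocalModels.

Section Cylinders.
Variables (R : realType) (T : topologicalType).
Implicit Types (X : bordism T) (O : marked_circle T).

(* A chart of the stratified surface X around x: a neighbourhood U of x in the
   surface is identified with the model M, x going to the origin, the boundary
   to B and the graph to G; no vertex other than x lies in U. *)
Definition strat_chart X (x : T) (M B G : set (R * R))
    (U : set T) (f : T -> R * R) (g : R * R -> T) : Prop :=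
  [/\ open_in (surf X) U /\ U x,
      homeo_on U M f g /\ f x = (0, 0),
      f @` (U `&` bdry X) = B,
      f @` (U `&` graph X) = G &
      U `&` verts X `<=` [set x]].

Definition is_cylinder X : Prop :=
  [/\ exists (f : T -> R * R * R) (g : R * R * R -> T),
        [/\ homeo_on (surf X) (@unit_circle R `*` ([set` `[0, 1]] : set R)) f g,
            circ (src X) = g @` (@unit_circle R `*` [set (0 : R)]) &
            circ (tgt X) = g @` (@unit_circle R `*` [set (1 : R)])],
      [/\ marks (src X) = graph X `&` circ (src X),
          marks (tgt X) = graph X `&` circ (tgt X),
          finite_set (marks (src X)) & finite_set (marks (tgt X))],
      [/\ graph X `<=` surf X, compact (graph X), verts X `<=` graph X,
          finite_set (verts X) & verts X `&` bdry X = set0],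
      forall v, verts X v ->
        exists U f g, strat_chart X v (@square R) set0 (@tripod R) U f g &
      (* The half-square charts express transversality to the boundary. *)
      (forall x, graph X x -> ~ verts X x -> ~ bdry X x ->
        exists U f g,
          strat_chart X x (@square R) set0 (@vertical_line R) U f g) /\
      (forall x, graph X x -> bdry X x ->
        exists U f g,
          strat_chart X x (@half_square R) (@half_square_bdry R)
            (@vertical_ray R) U f g)].

(* An edge is a connected component of the complement of the vertices in the
   graph; arcs ending on the boundary and vertex-free closed loops are
   included. *)
Definition edges X : set (set T) :=
  [set connected_component (graph X `\` verts X) x
     | x in graph X `\` verts X].

(* L lists the (germs of the) three half-edges of X at the vertex v. *)
Definition half_edges_at X (v : T) (L : 'I_3 -> set T) : Prop :=
  exists U f g, strat_chart X v (@square R) set0 (@tripod R) U f g /\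
    forall i, L i = g @` (@leg R i).

(* The three-element set {a, b, c}. *)
Definition color := 'I_3.

Definition coloring O : Type := marks O -> color.

Definition edge_coloring X : Type := edges X -> color.

HB.instance Definition _ O := Choice.copy (coloring O) (marks O -> color).
HB.instance Definition _ X :=
  Choice.copy (edge_coloring X) (edges X -> color).

Definition is_tait X (k : edge_coloring X) : Prop :=
  forall (v : T) (L : 'I_3 -> set T), verts X v -> half_edges_at X v L ->
  forall e : 'I_3 -> edges X, (forall i, L i `<=` \val (e i)) ->
  injective (k \o e).

Definition restricts_to X (k : edge_coloring X) O (c : coloring O) : Prop :=
  forall (e : edges X) (p : marks O), \val e (\val p) -> k e = c p.

Definition tait_colorings X (c1 : coloring (src X)) (c2 : coloring (tgt X)) :
    set (edge_coloring X) :=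
  [set k | [/\ is_tait k, restricts_to k c1 & restricts_to k c2]].

(* [fset_set] is empty on infinite sets; for a cylinder, and for its two parts
   below and above a generic cross-section, the set of colorings is finite. *)
Definition num_tait X (c1 : coloring (src X)) (c2 : coloring (tgt X)) : nat :=
  #|` fset_set (tait_colorings c1 c2)|.

Definition cross_section X (h : T -> R) (t : R) : marked_circle T :=
  MarkedCircle (surf X `&` [set x | h x = t])
               (graph X `&` (surf X `&` [set x | h x = t])).

(* The two parts of X cut along {h = t}; when {h = t} is a generic cross-section
   they are again cylinders. *)
Definition below X (h : T -> R) (t : R) : bordism T :=
  Bordism (src X) (cross_section X h t)
    (surf X `&` [set x | h x <= t]) (graph X `&` [set x | h x <= t])
    (verts X `&` [set x | h x <= t]).

Definition above X (h : T -> R) (t : R) : bordism T :=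
  Bordism (cross_section X h t) (tgt X)
    (surf X `&` [set x | t <= h x]) (graph X `&` [set x | t <= h x])
    (verts X `&` [set x | t <= h x]).

(* The level set {h = t} is a circle separating the in- from the out-boundary,
   with finitely many marked points, and has a neighbourhood in the interior
   which, as a stratified surface, is a product. *)
Definition generic_cross_section X (h : T -> R) (t : R) : Prop :=
  [/\ {within surf X, continuous h},
      forall x, circ (src X) x -> h x < t,
      forall x, circ (tgt X) x -> t < h x &
      exists (eps : R) (P : set (R * R)) (U : set T)
             (f : T -> R * R * R) (g : R * R * R -> T),
        [/\ 0 < eps /\ open_in (surf X) U,
            homeo_on U (@unit_circle R `*` ([set` `]- eps, eps[] : set R)) f g,
            circ (cross_section X h t) = g @` (@unit_circle R `*` [set (0 : R)]),
            [/\ P `<=` @unit_circle R, finite_set P &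
                U `&` graph X = g @` (P `*` ([set` `]- eps, eps[] : set R))] &
            U `&` (verts X `|` bdry X) = set0]].

End Cylinders.

Arguments num_tait R {T} X c1 c2.
Arguments is_cylinder R {T} X.

(* Main.v *)
Require Import Defs.
From mathcomp Require Import all_boot all_order all_algebra finmap.
From mathcomp Require Import all_classical all_reals all_analysis.
From mathcomp Require Import lra.

(* A coloring of the edges of a cylinder is the same thing as a coloring of the
   points of its graph, vertices removed, that is constant on connected sets.
   In this form, colorings of the two parts that agree on the cross-section can
   be glued, and it suffices that the glued coloring is locally constant: away
   from the cross-section this holds in a small chart, and near a marked point
   of the cross-section the product neighbourhood exhibits the graph as two
   half-arcs through that point, each contained in one of the two parts. The
   condition at a vertex is local, because charts can be shrunk into {h < t} or
   {t < h}. By compactness there are finitely many edges, so the bijection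
   can be counted fibrewise over the colorings of the cross-section. *)

Set Implicit Arguments.
Unset Strict Implicit.
Unset Printing Implicit Defensive.

Import Order.TTheory GRing.Theory Num.Theory.
Import numFieldNormedType.Exports.

Local Open Scope classical_set_scope.
Local Open Scope ring_scope.

(** * Counting over fibres, and finiteness of sets of functions *)

Lemma card_fset_setX (T1 T2 : choiceType) (A : set T1) (B : set T2) :
  finite_set A -> finite_set B ->
  #|` fset_set (A `*` B)| = (#|` fset_set A| * #|` fset_set B|)%N.
Proof.
move=> fA fB; rewrite fset_setX //.
rewrite -(size_allpairs pair (fset_set A) (fset_set B)).
apply/perm_size/uniq_perm; first exact: fset_uniq.
  by apply: allpairs_uniq => // -[? ?] [? ?].
move=> -[a b]; rewrite in_fsetM /=; apply/andP/allpairsP => [[Aa Bb]|].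
  by exists (a, b).
by move=> [[? ?] /= [? ? [-> ->]]].
Qed.

Lemma card_fset_set_inj (T1 T2 : choiceType) (A : set T1) (f : T1 -> T2) :
  finite_set A -> {in A &, injective f} ->
  #|` fset_set (f @` A)| = #|` fset_set A|.
Proof.
move=> fA fI; rewrite fset_set_image // card_in_imfset //=.
by move=> x y; rewrite !in_fset_set // => ? ?; apply: fI.
Qed.

(* The sets [B1 d] and [B2 d] may be infinite, but only when the other one is
   empty, in which case the summand is 0 as it should. *)
Lemma card_fiber_product (S C S1 S2 : choiceType) (A : set S)
    (B1 : C -> set S1) (B2 : C -> set S2)
    (c : S -> C) (f1 : S -> S1) (f2 : S -> S2) :
  finite_set A ->
  (forall k, A k -> B1 (c k) (f1 k) /\ B2 (c k) (f2 k)) ->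
  (forall k l, A k -> A l -> f1 k = f1 l -> f2 k = f2 l -> k = l) ->
  (forall d a b, B1 d a -> B2 d b ->
     exists k, [/\ A k, c k = d, f1 k = a & f2 k = b]) ->
  #|` fset_set A| =
  \sum_(d \in [set: C]) (#|` fset_set (B1 d)| * #|` fset_set (B2 d)|)%N.
Proof.
move=> fA fB inj surj.
pose fib d := A `&` [set k | c k = d].
have ffib d : finite_set (fib d) by apply: sub_finite_set fA => ? [].
have fibE d : (fun k => (f1 k, f2 k)) @` fib d = B1 d `*` B2 d.
  apply/seteqP; split=> [_ [k [Ak <-] <-]|[a b] [/= Ba Bb]].
    by have [] := fB _ Ak.
  by have [k [Ak ck <- <-]] := surj _ _ _ Ba Bb; exists k.
(* Only the values taken by [c] on [A] contribute: elements of both [B1 d] and [B2 d] would glue to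
   some [k] in [A] with [c k = d]. *)
rewrite -(@fsbig_widen _ _ _ _ (c @` A)) //; last first.
  move=> d [_ /= dA]; have [->|/set0P[a Ba]] := eqVneq (B1 d) set0.
    by rewrite fset_set0 cardfs0.
  have [->|/set0P[b Bb]] := eqVneq (B2 d) set0.
    by rewrite fset_set0 cardfs0 muln0.
  by case: dA; have [k [Ak <- _ _]] := surj _ _ _ Ba Bb; exists k.
rewrite fsbig_finite /=; last exact: finite_image.
rewrite fset_set_image // card_fset_sum1 (partition_big_imfset _ c) /=.
rewrite -[in RHS]fset_set_image // big_seq [RHS]big_seq.
rewrite fset_set_image //; apply: eq_bigr => d /imfsetP[k /=].
rewrite in_fset_set // inE => Ak dE.
have [Bk1 Bk2] := fB _ Ak; rewrite -dE in Bk1 Bk2.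
have fX : finite_set (B1 d `*` B2 d) by rewrite -fibE; apply: finite_image.
(* Both factors are inhabited at [d = c k], so each is a projection of the finite product. *)
have f1' : finite_set (B1 d).
  apply: sub_finite_set (finite_image fst fX) => a Ba.
  by exists (a, f2 k).
have f2' : finite_set (B2 d).
  apply: sub_finite_set (finite_image snd fX) => b Bb.
  by exists (f1 k, b).
rewrite -card_fset_setX // -fibE card_fset_set_inj //; last first.
  move=> l m; rewrite !inE => -[Al _] [Am _] [E1 E2]; exact: inj.
rewrite card_fset_sum1 -big_filter; apply: perm_big; apply: uniq_perm.
- exact/filter_uniq/fset_uniq.
- exact: fset_uniq.
move=> l; rewrite mem_filter !in_fset_set //.
apply/andP/idP; rewrite !inE.
  by move=> [/eqP ? ?]; split.
by move=> [? /= ->].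
Qed.

(** A function on [E] factors through the finite type [fset_set E], and the finite functions from
    there to [F] form a finite type. *)
Lemma finite_set_fun (T : choiceType) (E : set T) (F : finType)
    (A : set (E -> F)) : finite_set E -> finite_set A.
Proof.
move=> fE.
have memE (e : E) : \val e \in fset_set E.
  by rewrite in_fset_set //; exact: valP.
pose u (phi : {ffun fset_set E -> F}) (e : E) := phi [` memE e]%fset.
apply: (@sub_finite_set _ _ (u @` setT)); last first.
  exact/finite_image/finite_finset.
have memE' (x : fset_set E) : \val x \in E.
  by rewrite -(in_fset_set fE); exact: valP.
move=> k _; exists [ffun x => k (exist _ (\val x) (memE' x))] => //.
by apply/funext => e; rewrite /u ffunE; congr k; apply/val_inj.
Qed.

(** * Compactness, connectedness and relatively open sets *)

(** Finitely many of the neighbourhoods [W] would cover [K], and [P] passes to finite unions and to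
    subsets. The argument is phrased with filters instead of covers; it serves to count edges. *)
Lemma compact_ind (T : topologicalType) (K : set T) (P : set T -> Prop) :
  compact K -> P set0 -> (forall A B, P A -> P B -> P (A `|` B)) ->
  (forall A B, A `<=` B -> P B -> P A) ->
  (forall x, K x -> exists2 W, nbhs x W & P (K `&` W)) -> P K.
Proof.
move=> cK P0 PU PS PW; apply: contrapT => nPK.
(* A cluster point of this filter has no neighbourhood as in the hypothesis. *)
pose F : set_system T := fun B => P (K `\` B).
have FF : ProperFilter F.
  apply: Build_ProperFilter_ex => [B FB|].
    apply: contrapT => /forallNP B0; apply: nPK.
    by apply: PS FB => x Kx; split=> // /B0.
  split.
  - by rewrite /F setDT.
  - move=> B C FB FC; rewrite /F setDIr; exact: PU.
  - by move=> B C BC; apply: PS => x [Kx Cx]; split=> // /BC.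
have [|x [Kx xF]] := cK F FF; first by rewrite /F setDv.
have [W Wx PKW] := PW x Kx.
have [|y [? ?]] := xF (~` W) W _ Wx; last by [].
by apply: PS PKW => y [Ky /contrapT].
Qed.

(** Each level set of [f] is relatively open in [C], hence also relatively closed, its complement in
    [C] being the union of the other level sets. *)
Lemma locally_constant_connected (T : topologicalType) (V : Type) (C : set T)
    (f : T -> V) :
  connected C ->
  (forall x, C x ->
     exists2 W, open_nbhs x W & forall y, C y -> W y -> f y = f x) ->
  forall x y, C x -> C y -> f x = f y.
Proof.
move=> cC lc x y Cx Cy.
pose W v :=
  \bigcup_(U in [set U | open U /\ forall z, C z -> U z -> f z = v]) U.
have oW v : open (W v) by apply: bigcup_open => U [].
have WE v z : C z -> W v z <-> f z = v.
  move=> Cz; split=> [[U [_ + Uz]]|<-]; first exact.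
  by have [U [oU Uz] UP] := lc _ Cz; exists U.
suff: C `&` W (f x) = C.
  by move=> E; have := Cy; rewrite -{1}E => -[_ /(WE _ _ Cy)].
apply: cC.
- by exists x; split=> //; apply/WE.
- by exists (W (f x)).
- exists (~` \bigcup_(w in [set w | w <> f x]) W w).
    by apply: open_closedC; apply: bigcup_open.
  apply/seteqP; split=> z [Cz].
    move=> /(WE _ _ Cz) Wz; split=> // -[w /= + /(WE _ _ Cz)].
    by rewrite Wz => /[swap] ->.
  move=> nz; split=> //; apply/WE => //; apply: contrapT => fzx; apply: nz.
  by exists (f z) => //; apply/WE.
Qed.

Lemma open_inP (T : topologicalType) (A U : set T) :
  open_in A U <-> U `<=` A /\ forall x, U x -> within A (nbhs x) U.
Proof.
split=> [[W oW ->]|[UA UP]].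
  split=> [x []//|x [Ax Wx]]; rewrite /within/=.
  by apply: filterS (open_nbhs_nbhs (conj oW Wx)) => y Wy Ay.
(* This is the largest open set whose trace on [A] lies in [U]. *)
exists [set x | nbhs x [set y | A y -> U y]]°.
  exact: open_interior.
apply/seteqP; split=> [x Ux|x [Ax /interior_subset/nbhs_singleton]]; last exact.
split; first exact: UA.
exact/nbhs_interior/UP.
Qed.

Lemma open_in_trans (T : topologicalType) (A B C : set T) :
  open_in A B -> open_in B C -> open_in A C.
Proof.
by move=> [V oV ->] [W oW ->]; exists (V `&` W); [exact: openI|rewrite setIA].
Qed.

Lemma open_in_preimage (T U : topologicalType) (A : set T) (f : T -> U)
    (W : set U) :
  {within A, continuous f} -> open W -> open_in A (A `&` f @^-1` W).
Proof.
move=> /subspace_continuousP cf oW; apply/open_inP; split=> [x []//|x [Ax Wx]].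
have := cf x Ax W (open_nbhs_nbhs (conj oW Wx)).
rewrite /within/= /nbhs/=; apply: filterS => y; tauto.
Qed.

Lemma continuous_within_comp (T U V : topologicalType) (A : set T) (B : set U)
    (f : T -> U) (g : U -> V) :
  set_fun A B f -> {within A, continuous f} -> {within B, continuous g} ->
  {within A, continuous (g \o f)}.
Proof.
move=> fAB /subspace_continuousP cf /subspace_continuousP cg.
apply/subspace_continuousP => x Ax W /(cg _ (fAB _ Ax)) /=.
rewrite /nbhs/= => /(cf x Ax); rewrite /within /nbhs/=.
by apply: filterS => y Wy Ay; apply: Wy => //; apply: fAB.
Qed.

(** * Charts *)

Section Charts.
Variables (R : realType) (T : topologicalType).
Implicit Types (X Y : bordism T) (M B G S : set (R * R)) (U N : set T).

Definition arcs X := graph X `\` verts X.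

Lemma strat_chart_graph X x M B G U f g :
  strat_chart X x M B G U f g -> U `&` graph X = g @` G.
Proof.
move=> [_ [[_ _ fK _ _] _] _ <- _]; rewrite image_comp.
apply/seteqP; split=> [y [Uy Gy]|_ [y [Uy Gy] <-]] /=.
  by exists y => //=; rewrite fK ?inE.
by rewrite fK ?inE.
Qed.

Lemma strat_chart_sub X x M B G U f g :
  strat_chart X x M B G U f g -> G `<=` M.
Proof.
by move=> [_ [[fUM _ _ _ _] _] _ <- _] _ [y [Uy _] <-]; exact: fUM.
Qed.

Definition dilate (s : R) (q : R * R) : R * R := (s * q.1, s * q.2).

(** Invariance under contraction towards the origin, as far as a bounded set allows: a converse
    dilation may leave the model, but only by leaving the square. All local models have this
    property. *)
Definition conic S := S `<=` @square R /\
  forall s q, 0 < s <= 1 -> square q -> S (dilate s q) <-> S q.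

Lemma squareP a b : @square R (a, b) <-> -1 < a < 1 /\ -1 < b < 1.
Proof. by rewrite /square /setX /= !in_itv. Qed.

Lemma vertical_lineP a b : @vertical_line R (a, b) <-> a = 0 /\ -1 < b < 1.
Proof. by rewrite /vertical_line /setX /= in_itv. Qed.

Lemma half_squareP a b : @half_square R (a, b) <-> -1 < a < 1 /\ 0 <= b < 1.
Proof. by rewrite /half_square /setX /= !in_itv. Qed.

Lemma half_square_bdryP a b :
  @half_square_bdry R (a, b) <-> -1 < a < 1 /\ b = 0.
Proof. by rewrite /half_square_bdry /setX /= !in_itv. Qed.

Lemma vertical_rayP a b : @vertical_ray R (a, b) <-> a = 0 /\ 0 <= b < 1.
Proof. by rewrite /vertical_ray /setX /= in_itv. Qed.

Lemma legP i (q : R * R) :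
  leg i q <-> exists2 u, 0 < u < 1 & q = dilate u (leg_dir R i).
Proof.
by split=> -[u uI qE]; exists u => //; move: uI; rewrite /= in_itv.
Qed.

Lemma scale_eq0 (s x : R) : 0 < s -> s * x = 0 <-> x = 0.
Proof.
move=> s0; split=> [/eqP|->]; last exact: mulr0.
by rewrite mulf_eq0 gt_eqF //= => /eqP.
Qed.

Lemma dilate_eq0 s (q : R * R) : 0 < s -> dilate s q = (0, 0) -> q = (0, 0).
Proof. by case: q => a b s0 [/(scale_eq0 _ s0) -> /(scale_eq0 _ s0) ->]. Qed.

Lemma conic_square : conic (@square R).
Proof.
split=> // s [a b] /andP/=[s0 s1] ab; split=> // _; move: ab.
by move=> /squareP/=[? ?]; apply/squareP; split=> /=; nra.
Qed.

Lemma conic_set0 : conic set0.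
Proof. by split. Qed.

Lemma conic_vertical_line : conic (@vertical_line R).
Proof.
split=> [[a b]|s [a b] /andP/=[s0 s1] /squareP/=[? ?]].
  by move=> /vertical_lineP/=[-> ?]; apply/squareP; split=> //; lra.
by split=> /vertical_lineP/=[/(scale_eq0 _ s0) ? ?]; apply/vertical_lineP;
  split; rewrite /= ?scale_eq0 //; nra.
Qed.

Lemma conic_half_square : conic (@half_square R).
Proof.
split=> [[a b]|s [a b] /andP/=[s0 s1] /squareP/=[? ?]].
  by move=> /half_squareP/=[? ?]; apply/squareP; split=> //; lra.
by split=> /half_squareP/=[? ?]; apply/half_squareP; split=> /=; nra.
Qed.

Lemma conic_half_square_bdry : conic (@half_square_bdry R).
Proof.
split=> [[a b]|s [a b] /andP/=[s0 s1] /squareP/=[? ?]].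
  by move=> /half_square_bdryP/=[? ->]; apply/squareP; split=> //; lra.
by split=> /half_square_bdryP/=[? /(scale_eq0 _ s0) ?];
  apply/half_square_bdryP; split; rewrite /= ?scale_eq0 //; nra.
Qed.

Lemma conic_vertical_ray : conic (@vertical_ray R).
Proof.
split=> [[a b]|s [a b] /andP/=[s0 s1] /squareP/=[? ?]].
  by move=> /vertical_rayP/=[-> ?]; apply/squareP; split=> //; lra.
by split=> /vertical_rayP/=[/(scale_eq0 _ s0) ? ?]; apply/vertical_rayP;
  split; rewrite /= ?scale_eq0 //; nra.
Qed.

Lemma conic_leg i : conic (@leg R i).
Proof.
split=> [_ /legP[u uI ->]|s [a b] /andP/=[s0 s1] ab].
  by case: i => -[|[|[|//]]] ? /=; apply/squareP; rewrite /=; split; lra.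
split=> /legP[u uI]; last first.
  move=> [-> ->]; apply/legP; exists (s * u); first by nra.
  by rewrite /dilate /= !mulrA.
move=> [Ea Eb]; apply/legP; have s0' : s != 0 by rewrite gt_eqF.
have us : s * (u / s) = u by rewrite mulrCA divff ?mulr1.
move: (u / s) us => w us; rewrite -us -!mulrA in uI Ea Eb.
move/(mulfI s0'): Ea => Ea; move/(mulfI s0'): Eb => Eb.
exists w; last by rewrite Ea Eb.
(* The bound [w < 1] comes from the square: each [leg_dir] has a coordinate of absolute value 1. *)
move: ab Ea Eb => /squareP[? ?].
by case: i => -[|[|[|//]]] ? /= Ea Eb; nra.
Qed.

Lemma conic_tripod : conic (@tripod R).
Proof.
split=> [_ [->|[i _ /(conic_leg i).1 //]]|s q s01 qS].
  by apply/squareP; split; lra.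
have s0 : 0 < s by case/andP: s01.
split=> -[q0|[i _ qi]]; [left|right|left|right].
- exact: dilate_eq0 q0.
- by exists i => //; apply/((conic_leg i).2 s q).
- by rewrite q0 /dilate /= !mulr0.
- by exists i => //; apply/((conic_leg i).2 s q).
Qed.

End Charts.

(** * Rescaling charts into smaller neighbourhoods *)

Section ShrinkingCharts.
Variables (R : realType) (T : topologicalType).
Implicit Types (X Y : bordism T) (M B G S : set (R * R)) (U N : set T).

Lemma openX (T1 T2 : topologicalType) (A : set T1) (B : set T2) :
  open A -> open B -> open (A `*` B).
Proof.
move=> oA oB; rewrite (_ : _ `*` _ = fst @^-1` A `&` snd @^-1` B) //.
by apply: openI; apply: open_comp => // ? _; [exact: cvg_fst|exact: cvg_snd].
Qed.

Lemma open_square : open (@square R).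
Proof. by apply: openX; exact: interval_open. Qed.

Lemma continuous_pair (T1 T2 T3 : topologicalType) (f : T1 -> T2)
    (g : T1 -> T3) :
  continuous f -> continuous g -> continuous (fun x => (f x, g x)).
Proof.
move=> cf cg x.
by apply: (@cvg_pair _ _ _ _ (nbhs (f x)) (nbhs (g x))); [exact: cf|exact: cg].
Qed.

Lemma dilate_continuous (s : R) : continuous (dilate s).
Proof.
apply: continuous_pair => q.
- by apply: cvgM; [exact: cvg_cst|exact: cvg_fst].
- by apply: cvgM; [exact: cvg_cst|exact: cvg_snd].
Qed.

Lemma dilateK (s : R) : s != 0 -> cancel (dilate s^-1) (dilate s).
Proof. by move=> s0 [a b]; rewrite /dilate /= !mulrA divff // !mul1r. Qed.

Lemma dilateVK (s : R) : s != 0 -> cancel (dilate s) (dilate s^-1).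
Proof. by move=> s0 [a b]; rewrite /dilate /= !mulrA mulVf // !mul1r. Qed.

Lemma strat_chart_shrink X x M B G U f g N :
  conic M -> conic B -> conic G -> strat_chart X x M B G U f g ->
  open_in (surf X) N -> N x ->
  exists U' f' s, [/\ 0 < s <= 1, U' `<=` N &
    strat_chart X x M B G U' f' (g \o dilate s)].
Proof.
move=> cM cB cG [[oU Ux] [[fUM gMU fK gK [cf cg]] fx] fB fG vU] oN Nx.
have Us : U `<=` surf X by case: oU => W _ ->; exact: subIsetl.
have [W oW NE] := oN.
have M0 : M (0, 0) by rewrite -fx; exact: fUM.
have g0 : g (0, 0) = x by rewrite -fx fK ?inE.
have : within M (nbhs ((0, 0) : R * R)) (g @^-1` W).
  have nW : nbhs (g (0, 0)) W.
    rewrite g0; apply: open_nbhs_nbhs; split=> //.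
    by move: Nx; rewrite NE => -[].
  by move/subspace_continuousP: cg => /(_ _ M0 _ nW).
rewrite /within /= => /nbhs_ballP[d /= d0 dW].
(* The bound by [d] sends the dilated model into the ball that [g] maps to [W]; the bound by 1 is
   what [conic] asks for. *)
pose s := Num.min 1 d.
have s01 : 0 < s <= 1 by rewrite lt_min ltr01 d0 ge_min lexx.
have /andP[s0 s1] := s01.
have sn0 : s != 0 by rewrite gt_eqF.
have sW q : M q -> W (g (dilate s q)).
  move=> Mq; apply: dW; last exact/(cM.2 s q s01 (cM.1 _ Mq)).
  have sd : s <= d by rewrite ge_min lexx orbT.
  case: q {Mq} (cM.1 _ Mq) => a b /squareP[? ?].
  by split; rewrite /ball /= sub0r normrN ltr_norml; apply/andP; split; nra.
pose U' := U `&` (dilate s^-1 \o f) @^-1` @square R.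
have cf' : {within U, continuous (dilate s^-1 \o f)}.
  apply: within_continuous_comp => // p _; exact: dilate_continuous.
have fM' y : U' y -> M (dilate s^-1 (f y)).
  move=> [Uy ys]; apply/(cM.2 s _ s01 ys); rewrite dilateK //; exact: fUM.
have sM q : M q -> M (dilate s q).
  by move=> Mq; apply/(cM.2 s q s01 (cM.1 _ Mq)).
have gU' q : M q -> U' (g (dilate s q)).
  move=> Mq; split; first exact/gMU/sM.
  by rewrite /= gK ?inE ?dilateVK //; [exact: cM.1|exact: sM].
(* Stated for an arbitrary stratum [Z], since it is applied to the boundary and to the graph. *)
have imE (Z : set T) S : conic S -> f @` (U `&` Z) = S ->
    (dilate s^-1 \o f) @` (U' `&` Z) = S.
  move=> cS fZ; apply/seteqP; split=> [_ [y [[Uy ys] Zy] <-]|q Sq].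
    apply/(cS.2 s _ s01 ys); rewrite dilateK // -fZ; by exists y.
  have : S (dilate s q) by apply/(cS.2 s q s01 (cS.1 _ Sq)).
  rewrite -fZ => -[y [Uy Zy] fy]; exists y; last by rewrite /= fy dilateVK.
  by split=> //; split=> //; rewrite /= fy dilateVK //; exact: cS.1.
exists U', (dilate s^-1 \o f), s; split=> //.
  move=> y [Uy ys]; rewrite NE; split; first exact: Us.
  have := sW _ (fM' _ (conj Uy ys)).
  by rewrite dilateK // fK ?inE.
split.
- split; last first.
    by split=> //; rewrite /= fx /dilate /= mulr0; apply/squareP; split; lra.
  apply: open_in_trans oU _; apply: open_in_preimage => //; exact: open_square.
- split; last by rewrite /= fx /dilate /= mulr0.
  split.
  + by move=> y /fM'.
  + by move=> q /gU'.
  + by move=> y; rewrite inE => -[Uy _]; rewrite /= dilateK // fK ?inE.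
  + by move=> q; rewrite inE => Mq; rewrite /= gK ?inE ?dilateVK //; exact: sM.
  + split; first by apply: continuous_subspaceW cf'; exact: subIsetl.
    apply: (@continuous_within_comp _ _ _ M M) cg => //.
    apply: continuous_subspaceT; exact: dilate_continuous.
- exact: imE.
- exact: imE.
- by move=> y [[Uy _] Vy]; exact: vU.
Qed.

End ShrinkingCharts.

(** * Local structure of the graph and finiteness of its edges *)

Section LocalStructure.
Variables (R : realType) (T : topologicalType).
Implicit Types (X Y : bordism T) (M B G S : set (R * R)) (U N : set T).

(** Meant for a cylinder and one of its two parts, with [N] an open set that keeps away from the
    cross-section. *)
Definition agree_on N X Y :=
  [/\ N `&` surf X = N `&` surf Y, N `&` graph X = N `&` graph Y,
      N `&` verts X = N `&` verts Y & N `&` bdry X = N `&` bdry Y].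

Lemma strat_chart_agree X Y N x M B G U f g :
  agree_on N X Y -> open N -> U `<=` N ->
  strat_chart X x M B G U f g -> strat_chart Y x M B G U f g.
Proof.
move=> [eS eG eV eB] oN UN [[[W oW UE] Ux] hU fB fG vU].
have UI : U `&` N = U by exact/setIidPl.
split=> //.
- split=> //; exists (N `&` W); first exact: openI.
  by rewrite setIA (setIC (surf Y)) -eS (setIC N) -setIA (setIC N) setIA -UE UI.
- by rewrite -fB -UI -!setIA eB.
- by rewrite -fG -UI -!setIA eG.
- by rewrite -UI -setIA -eV setIA UI.
Qed.

Lemma connected_segment (a : R * R) (i : interval R) :
  connected ((fun u => dilate u a) @` [set` i]).
Proof.
apply: connected_continuous_connected.
  exact/connected_intervalP/interval_is_interval.
apply: continuous_subspaceT; apply: continuous_pair => u;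
  by apply: cvgM; [exact: cvg_id|exact: cvg_cst].
Qed.

Lemma connected_leg i : connected (@leg R i).
Proof. exact: connected_segment. Qed.

Lemma connected_vertical (i : interval R) :
  connected ([set (0 : R)] `*` [set` i]).
Proof.
rewrite (_ : _ `*` _ = (fun u => dilate u (0, 1)) @` [set` i]).
  exact: connected_segment.
apply/seteqP; split=> [[a b] [/= -> bi]|_ [u ui <-]].
  by exists b => //; rewrite /dilate /= mulr0 mulr1.
by split; rewrite //= ?mulr0 ?mulr1.
Qed.

Lemma strat_chart_connected X x M B G U f g S :
  strat_chart X x M B G U f g -> S `<=` G -> connected S -> connected (g @` S).
Proof.
move=> ch SG cS; apply: connected_continuous_connected => //.
have SM := subset_trans SG (strat_chart_sub ch).
by move: ch => [_ [[_ _ _ _ [_ cg]] _] _ _ _]; exact: continuous_subspaceW cg.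
Qed.

(** In the shrunk chart the graph is the image of the connected model [G]; only [x] could be a
    vertex there, and it is not. *)
Lemma strat_chart_arc X x M B G U f g N :
  conic M -> conic B -> conic G -> connected G ->
  strat_chart X x M B G U f g -> ~ verts X x -> open_in (surf X) N -> N x ->
  graph X `<=` surf X ->
  exists W C, [/\ open_nbhs x W, connected C, C `<=` arcs X `&` N &
    W `&` arcs X `<=` C].
Proof.
move=> cM cB cG conG ch nVx oN Nx GS.
have [U' [f' [s [_ U'N ch']]]] := strat_chart_shrink cM cB cG ch oN Nx.
have [[[W oW U'E] U'x] _ _ _ vU'] := ch'.
exists W, (U' `&` graph X); split.
- by split=> //; move: U'x; rewrite U'E => -[].
- by rewrite (strat_chart_graph ch'); apply: strat_chart_connected ch' _ _.
- move=> y [U'y Gy]; split; last exact: U'N.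
  by split=> // Vy; apply: nVx; rewrite -(vU' y).
- by move=> y [Wy [Gy _]]; split=> //; rewrite U'E; split=> //; exact: GS.
Qed.

Lemma cylinder_arc X x N : is_cylinder R X -> arcs X x ->
  open_in (surf X) N -> N x ->
  exists W C, [/\ open_nbhs x W, connected C, C `<=` arcs X `&` N &
    W `&` arcs X `<=` C].
Proof.
move=> [_ _ [GS _ _ _ _] _ [inner outer]] [Gx nVx] oN Nx.
have [bx|nbx] := pselect (bdry X x).
  have [U [f [g ch]]] := outer x Gx bx.
  apply: strat_chart_arc ch _ oN Nx _ => //.
  - exact: conic_half_square.
  - exact: conic_half_square_bdry.
  - exact: conic_vertical_ray.
  - exact: connected_vertical.
have [U [f [g ch]]] := inner x Gx nVx nbx.
apply: strat_chart_arc ch _ oN Nx _ => //.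
- exact: conic_square.
- exact: conic_vertical_line.
- exact: connected_vertical.
Qed.

Lemma half_edges_atP X v (L : 'I_3 -> set T) i : half_edges_at R X v L ->
  [/\ connected (L i), L i !=set0 & L i `<=` arcs X].
Proof.
move=> [U [f [g [ch LE]]]]; rewrite LE.
have legT : leg i `<=` @tripod R by move=> q qi; right; exists i.
split.
  exact: strat_chart_connected ch legT (@connected_leg i).
- exists (g (dilate 2^-1 (leg_dir R i))).
  exists (dilate 2^-1 (leg_dir R i)) => //.
  by apply/legP; exists 2^-1 => //; lra.
move=> y [q qi <-].
have : (g @` @tripod R) (g q) by exists q => //; exact: legT.
rewrite -(strat_chart_graph ch) => -[Ugq Ggq]; split=> // Vgq.
have [_ [[_ _ _ gK _] fv] _ _ vU] := ch.
(* A vertex in the chart can only be [v], which sits at the origin, and no leg contains the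
   origin. *)
have q0 : q = (0, 0).
  rewrite -[q]gK ?inE; last exact/(strat_chart_sub ch)/legT.
  by rewrite (vU _ (conj Ugq Vgq)).
move: qi; rewrite q0 => /legP[u u01] {q0 fv}.
by case: i {legT} => -[|[|[|//]]] ? /= [? ?]; nra.
Qed.

Lemma strat_chart_half_edges X v B M U f g :
  strat_chart X v M B (@tripod R) U f g ->
  U `&` arcs X `<=` [set v] `|` \bigcup_i (g @` @leg R i).
Proof.
move=> ch y [Uy [Gy _]].
have : (U `&` graph X) y by [].
rewrite (strat_chart_graph ch) => -[q [->|[i _ qi]] <-]; last first.
  by right; exists i => //; exists q.
by left; have [[_ Uv] [[_ _ fK _ _] <-] _ _ _] := ch; rewrite /= fK ?inE.
Qed.

(** By compactness of the graph it suffices to count near each point: at most three edges come close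
    to a vertex, and a single one to any other point. *)
Lemma finite_edges X : is_cylinder R X -> finite_set (edges X).
Proof.
move=> HX; have [_ _ [GS cG _ _ _] vert _] := HX.
pose P (B : set T) := finite_set [set e | edges X e /\ e `&` B !=set0].
suff PG : P (graph X).
  apply: sub_finite_set PG => _ [x Ax <-]; split; first by exists x.
  by exists x; split; [exact: connected_component_refl|case: Ax].
apply: (@compact_ind _ _ P cG).
- by rewrite /P (_ : [set _ | _] = set0) // -subset0 => e [_ [x []]].
- move=> A B fA fB; have : P A /\ P B by [].
  rewrite /P -finite_setU; apply: sub_finite_set.
  by move=> e [Xe [x [ex [?|?]]]]; [left|right]; split=> //; exists x.
- move=> A B AB; apply: sub_finite_set => e [Xe [x [ex Ax]]]; split=> //.
  by exists x; split=> //; exact: AB.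
move=> x Gx.
(* Three base points serve both cases: one on each leg at a vertex, and [x] itself three times
   elsewhere. *)
suff [W nW [c cW]] : exists2 W, nbhs x W & exists c : 'I_3 -> T,
    forall y, W y -> arcs X y -> exists i, connected_component (arcs X) (c i) y.
  exists W => //.
  apply: (@sub_finite_set _ _
      ((fun i => connected_component (arcs X) (c i)) @` setT)).
    move=> _ [[z Az <-] [y [zy [Gy Wy]]]].
    have [i iy] := cW y Wy (connected_component_sub zy).
    exists i => //.
    by rewrite (same_connected_component iy) (same_connected_component zy).
  exact/finite_image/finite_finset.
have [Vx|nVx] := pselect (verts X x); last first.
  have [||W [C [[oW Wx] conC CA WC]]] :=
    @cylinder_arc X x (surf X) HX (conj Gx nVx).
  - by exists setT; [exact: openT|rewrite setIT].
  - exact: GS.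
  exists W; first exact: open_nbhs_nbhs.
  exists (fun=> x) => y Wy Ay; exists ord0.
  apply: (@connected_component_max _ _ C) => //; try exact: WC.
  by move=> z /CA[].
have [U [f [g ch]]] := vert x Vx.
have Hx : half_edges_at R X x (fun i => g @` @leg R i) by exists U, f, g.
have [[[W oW UE] Ux] _ _ _ vU] := ch.
exists W.
  by apply: open_nbhs_nbhs; split=> //; move: Ux; rewrite UE => -[].
have H i : exists y, (g @` @leg R i) y.
  by have [_ [y Ly] _] := half_edges_atP i Hx; exists y.
have [c cL] := choice H; exists c => y Wy Ay.
have Uy : U y by rewrite UE; split=> //; apply: GS; case: Ay.
have [yx|[i _ Liy]] := strat_chart_half_edges ch (conj Uy Ay).
  by case: Ay => _; rewrite yx.
exists i; have [conL _ LA] := half_edges_atP i Hx.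
exact: (connected_component_max (cL i) LA (@conL)).
Qed.

End LocalStructure.

(** * Edge colorings as locally constant functions *)

Section PointColorings.
Variable T : topologicalType.
Implicit Types (X : bordism T) (A : set T) (kappa : T -> color).

(** Quantifying over all connected subsets, not only over components, makes the condition pass to
    smaller [A], in particular from a cylinder to its parts. *)
Definition const_on_connected A kappa := forall C, connected C -> C `<=` A ->
  forall x y, C x -> C y -> kappa x = kappa y.

Lemma edges_component X x : arcs X x ->
  connected_component (arcs X) x \in edges X.
Proof. by move=> Ax; apply/mem_set; exists x. Qed.

Definition edge_at X x (Ax : arcs X x) : edges X :=
  exist (fun e => e \in edges X) _ (edges_component Ax).

Lemma edge_componentE X (e : edges X) x : \val e x ->
  arcs X x /\ \val e = connected_component (arcs X) x.
Proof.
have /set_mem[y Ay <-] := valP e => /= yx.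
split; [exact: connected_component_sub yx|exact: same_connected_component].
Qed.

Lemma edge_nonempty X (e : edges X) : \val e !=set0.
Proof.
have /set_mem[y Ay <-] := valP e.
by exists y; exact: connected_component_refl.
Qed.

(** The value [ord0] off the arcs is a dummy. *)
Definition color_at X (k : edge_coloring X) (x : T) : color :=
  if pselect (arcs X x) is left Ax then k (edge_at Ax)
  else ord0.

(** The color is read at a chosen point of each edge; the choice is immaterial when [kappa] is
    constant on connected sets. *)
Definition coloring_of X kappa : edge_coloring X :=
  fun e => kappa (sval (cid (edge_nonempty e))).

Lemma color_atE X (k : edge_coloring X) (e : edges X) x :
  \val e x -> color_at k x = k e.
Proof.
move=> ex; have [Ax eE] := edge_componentE ex.
rewrite /color_at; case: pselect => // Ax'; congr k.
by apply/val_inj; rewrite eE.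
Qed.

Lemma color_at_const X (k : edge_coloring X) :
  const_on_connected (arcs X) (color_at k).
Proof.
move=> C cC CA x y Cx Cy.
pose e := edge_at ((CA _ Cx)).
rewrite !(@color_atE _ _ e) //=.
  by apply: (connected_component_max _ CA (@cC)).
exact/connected_component_refl/CA.
Qed.

Lemma color_at_coloring_of X kappa x :
  const_on_connected (arcs X) kappa -> arcs X x ->
  color_at (coloring_of kappa : edge_coloring X) x = kappa x.
Proof.
move=> kC Ax; pose e := edge_at Ax.
have ex : \val e x by exact: connected_component_refl.
rewrite (color_atE _ ex) /coloring_of.
apply: (kC (\val e)) => //; first exact: component_connected.
- exact: connected_component_sub.
- exact: (svalP (cid (edge_nonempty e))).
Qed.

Lemma edge_coloring_ext X (k l : edge_coloring X) :
  (forall x, arcs X x -> color_at k x = color_at l x) -> k = l.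
Proof.
move=> kl; apply/funext => e; have [x ex] := edge_nonempty e.
by rewrite -!(color_atE _ ex) kl //; have [] := edge_componentE ex.
Qed.

(** A mark on the arcs lies on an edge, namely its component. At a mark off the arcs [restricts_to]
    would impose nothing, whence the inclusion. *)
Lemma restricts_toP X (k : edge_coloring X) O (c : coloring O) :
  marks O `<=` arcs X ->
  restricts_to k c <-> forall p : marks O, color_at k (\val p) = c p.
Proof.
move=> OX; split=> [kc p|kc e p ep]; last by rewrite -(color_atE _ ep).
have Ap : arcs X (\val p) by apply/OX/set_mem/valP.
pose e := edge_at Ap.
have ep : \val e (\val p) by exact: connected_component_refl.
by rewrite (color_atE _ ep); exact: kc.
Qed.

End PointColorings.

(** * Locality of the Tait condition at a vertex *)

(** Colors are sampled at points of the half-edges because points, unlike edges, are shared by a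
    cylinder and its parts. *)
Definition tait_at (R : realType) (T : topologicalType) (X : bordism T)
    (k : edge_coloring X) (v : T) :=
  forall (L : 'I_3 -> set T) (x : 'I_3 -> T), half_edges_at R X v L ->
  (forall i, L i (x i)) -> injective (color_at k \o x).

(** A half-edge is connected and avoids the vertices, so it lies in one edge and any of its points
    shows the color of that edge. *)
Lemma is_taitP (R : realType) (T : topologicalType) (X : bordism T)
    (k : edge_coloring X) :
  is_tait R k <-> forall v, verts X v -> tait_at R k v.
Proof.
split=> [tk v Vv L x hL Lx|tk v L Vv hL e Le].
  have A i : arcs X (x i) by have [_ _] := half_edges_atP i hL; exact.
  pose e i := edge_at (A i).
  have -> : color_at k \o x = k \o e.
    apply/funext => i /=; apply: color_atE; exact: connected_component_refl.
  apply: (tk _ _ Vv hL) => i; have [cL _ LA] := half_edges_atP i hL.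
  exact: (connected_component_max (Lx i) LA (@cL)).
have L0 i : exists y, L i y.
  by have [_ [y Ly] _] := half_edges_atP i hL; exists y.
have [x Lx] := choice L0.
have -> : k \o e = color_at k \o x.
  by apply/funext => i /=; rewrite (color_atE _ (Le _ _ (Lx i))).
exact: (tk v Vv L).
Qed.

Lemma agree_on_sym (T : topologicalType) (N : set T) (X Y : bordism T) :
  agree_on N X Y -> agree_on N Y X.
Proof. by case=> *; split; exact/esym. Qed.

(** A vertex chart of [X] may leave [N], so it is shrunk first; this shortens the half-edges. *)
Lemma half_edges_at_agree (R : realType) (T : topologicalType)
    (X Y : bordism T) (N : set T) v (L : 'I_3 -> set T) :
  open N -> agree_on N X Y -> N v -> half_edges_at R X v L ->
  exists2 L', half_edges_at R Y v L' & forall i, L' i `<=` L i.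
Proof.
move=> oN aN Nv [U [f [g [ch LE]]]].
have [[oU Uv] _ _ _ _] := ch.
have Sv : surf X v by case: oU Uv => W _ -> [].
have oI : open_in (surf X) (surf X `&` N) by exists N.
have [U' [f' [s [s01 U'N ch']]]] := strat_chart_shrink (@conic_square R)
  (@conic_set0 R) (@conic_tripod R) ch oI (conj Sv Nv).
exists (fun i => (g \o dilate s) @` @leg R i).
  exists U', f', (g \o dilate s); split=> //.
  apply: strat_chart_agree aN oN _ ch'.
  exact: subset_trans U'N (@subIsetr _ _ _).
move=> i _ [q qi <-]; rewrite LE; exists (dilate s q) => //.
have [ls lc] := @conic_leg R i.
by apply/(lc s q s01) => //; exact: ls.
Qed.

(** No shrinking here: a vertex chart of [Y] misses the boundary of [Y], hence already lies in
    [N]. *)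
Lemma half_edges_at_interior (R : realType) (T : topologicalType)
    (X Y : bordism T) (N : set T) v (L : 'I_3 -> set T) :
  open N -> agree_on N X Y -> surf Y `\` bdry Y `<=` N ->
  half_edges_at R Y v L -> half_edges_at R X v L.
Proof.
move=> oN aN YN [U [f [g [ch LE]]]]; exists U, f, g; split=> //.
apply: (strat_chart_agree (agree_on_sym aN) oN _ ch).
have [[oU _] _ fB _ _] := ch => y Uy; apply: YN.
split; first by case: oU Uy => W _ -> [].
by move=> by'; suff : set0 (f y) by []; rewrite -fB; exists y.
Qed.

Lemma tait_at_agree (R : realType) (T : topologicalType) (X Y : bordism T)
    (N : set T) (k : edge_coloring X) (l : edge_coloring Y) v :
  open N -> agree_on N X Y -> surf Y `\` bdry Y `<=` N -> N v ->
  (forall x, arcs Y x -> color_at k x = color_at l x) ->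
  tait_at R k v <-> tait_at R l v.
Proof.
move=> oN aN YN Nv kl.
have klE (L : 'I_3 -> set T) x : half_edges_at R Y v L ->
    (forall i, L i (x i)) -> color_at k \o x = color_at l \o x.
  move=> hL Lx; apply/funext => i; apply: kl.
  by have [_ _] := half_edges_atP i hL; exact.
split=> [tk|tl] L x hL Lx.
  rewrite -(klE _ _ hL Lx); apply: (tk L) => //.
  exact: (half_edges_at_interior oN aN YN hL).
(* The samples on the long half-edges of [X] are moved to the shortened ones, where [k] and [l] can
   be compared; the color of [k] does not change along a half-edge. *)
have [L' hL' L'L] := half_edges_at_agree oN aN Nv hL.
have L'0 i : exists y, L' i y.
  by have [_ [y Ly] _] := half_edges_atP i hL'; exists y.
have [y L'y] := choice L'0.
suff -> : color_at k \o x = color_at l \o y by exact: (tl L').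
rewrite -(klE _ _ hL' L'y); apply/funext => i /=.
have [cL _ LA] := half_edges_atP i hL.
by apply: (@color_at_const _ _ k (L i) (@cL) LA) => //; exact: L'L.
Qed.

(** Intermediate values: the image is an interval, so values on both sides of [t] would force the
    value [t]. *)
Lemma connected_avoid (R : realType) (J : set R) (phi : R -> R) (t : R) :
  connected J -> {within J, continuous phi} ->
  (forall r, J r -> phi r <> t) ->
  (forall r, J r -> phi r <= t) \/ (forall r, J r -> t <= phi r).
Proof.
move=> cJ cphi nt; have := connected_continuous_connected (@cJ) cphi.
move=> /connected_intervalP iI; apply: contrapT => /not_orP[].
move=> /existsNP[r /not_implyP[Jr /negP]]; rewrite -ltNge => tr.
move=> /existsNP[u /not_implyP[Ju /negP]]; rewrite -ltNge => ut.
have [|||w Jw] := iI (phi u) (phi r) _ _ t; last exact: nt.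
- by exists u.
- by exists r.
- by rewrite !ltW.
Qed.

(** * Cutting along a cross-section *)

Section CutCylinder.
Variables (R : realType) (T : topologicalType) (X : bordism T) (h : T -> R)
  (t : R).
Hypotheses (HX : is_cylinder R X) (Ht : generic_cross_section X h t).

Lemma bdry_surf : bdry X `<=` surf X.
Proof.
have [[f [g [[_ gC _ _ _] sE tE]]] _ _ _ _] := HX.
rewrite /bdry sE tE => _ [] [[p r] [/= pc ->] <-]; apply: gC; split=> //=;
  by rewrite in_itv /= lexx ler01.
Qed.

Lemma graph_surf : graph X `<=` surf X.
Proof. by have [_ _ [GS _ _ _ _] _ _] := HX. Qed.

(** The level circle is the core of the product neighbourhood, which contains neither vertices nor
    boundary points. *)
Lemma level_generic x : surf X x -> h x = t -> ~ verts X x /\ ~ bdry X x.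
Proof.
move=> Sx hx; have [_ _ _ [e [P [U [f [g]]]]]] := Ht.
move=> [[e0 _] [_ gU _ _ _] cE _ UV].
have : circ (cross_section X h t) x by [].
rewrite cE => -[[p r] [/= pc r0] gx].
have Ux : U x.
  by rewrite -gx; apply: gU; split=> //=; rewrite r0 in_itv /= oppr_lt0 e0.
split=> xV; suff : set0 x by []; rewrite -UV; split=> //; first by left.
by right.
Qed.

Lemma arcs_below : arcs (below X h t) = arcs X `&` [set x | h x <= t].
Proof.
by apply/seteqP; split=> x; rewrite /arcs /setD /setI /mkset /=; tauto.
Qed.

Lemma arcs_above : arcs (above X h t) = arcs X `&` [set x | t <= h x].
Proof.
by apply/seteqP; split=> x; rewrite /arcs /setD /setI /mkset /=; tauto.
Qed.

Lemma open_below : open_in (surf X) (surf X `&` [set x | h x < t]).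
Proof.
have [ch _ _ _] := Ht.
exact: (open_in_preimage ch (@open_lt R t)).
Qed.

Lemma open_above : open_in (surf X) (surf X `&` [set x | t < h x]).
Proof.
have [ch _ _ _] := Ht.
exact: (open_in_preimage ch (@open_gt R t)).
Qed.

(** As [h] is continuous only on the surface, [{h < t}] is replaced by an open set of the ambient
    space with the same trace. A point of the lower part not in it is at level [t], hence on the new
    boundary circle. *)
Lemma agree_below : exists N, [/\ open N,
  surf X `&` [set x | h x < t] `<=` N, agree_on N X (below X h t) &
  surf (below X h t) `\` bdry (below X h t) `<=` N].
Proof.
have [N oN NE] := open_below.
have SN : surf X `&` [set x | h x < t] `<=` N by rewrite NE; exact: subIsetr.
exists N; split=> //; last first.
  move=> x [[Sx /= xt] nbx]; apply: SN; split=> //=.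
  by rewrite lt_neqAle xt andbT; apply/eqP => hx; apply: nbx; right.
have Nlt x : N x -> surf X x -> h x < t.
  by move=> Nx Sx; have : (surf X `&` N) x by []; rewrite -NE => -[].
have [_ hs ht _] := Ht.
have sub (Z : set T) : Z `<=` surf X ->
    N `&` Z = N `&` (Z `&` [set x | h x <= t]).
  move=> ZS; apply/seteqP; split=> x [Nx]; last by move=> [].
  by move=> Zx; do !split=> //; apply/ltW/Nlt => //; exact: ZS.
have [_ _ [GS _ VG _ _] _ _] := HX.
split; [exact: sub|exact: sub|exact/sub/(subset_trans VG)|].
(* Only the in-boundary can meet [N]: the out-boundary of [X] lies above the level and that of the
   lower part lies on it. *)
apply/seteqP; split=> x [Nx bx]; split=> //; have := bx.
  move=> [sx|tx]; first by left.
  have := ht x tx; rewrite ltNge ltW //; apply: Nlt => //.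
  by apply: bdry_surf; right.
move=> [sx|[Sx hx]]; first by left.
by have := Nlt x Nx Sx; rewrite hx ltxx.
Qed.

Lemma agree_above : exists N, [/\ open N,
  surf X `&` [set x | t < h x] `<=` N, agree_on N X (above X h t) &
  surf (above X h t) `\` bdry (above X h t) `<=` N].
Proof.
have [N oN NE] := open_above.
have SN : surf X `&` [set x | t < h x] `<=` N by rewrite NE; exact: subIsetr.
exists N; split=> //; last first.
  move=> x [[Sx /= xt] nbx]; apply: SN; split=> //=.
  by rewrite lt_neqAle xt andbT; apply/eqP => hx; apply: nbx; left.
have Nlt x : N x -> surf X x -> t < h x.
  by move=> Nx Sx; have : (surf X `&` N) x by []; rewrite -NE => -[].
have [_ hs ht _] := Ht.
have sub (Z : set T) : Z `<=` surf X ->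
    N `&` Z = N `&` (Z `&` [set x | t <= h x]).
  move=> ZS; apply/seteqP; split=> x [Nx]; last by move=> [].
  by move=> Zx; do !split=> //; apply/ltW/Nlt => //; exact: ZS.
have [_ _ [GS _ VG _ _] _ _] := HX.
split; [exact: sub|exact: sub|exact/sub/(subset_trans VG)|].
apply/seteqP; split=> x [Nx bx]; split=> //; have := bx.
  move=> [sx|tx]; last by right.
  have := hs x sx; rewrite ltNge ltW //; apply: Nlt => //.
  by apply: bdry_surf; left.
move=> [[Sx hx]|tx]; last by right.
by have := Nlt x Nx Sx; rewrite hx ltxx.
Qed.

(** The condition is local at each vertex, and every vertex lies strictly on one side of the level,
    where [X] agrees with the corresponding part. *)
Lemma is_tait_cut (k : edge_coloring X)
    (k1 : edge_coloring (below X h t)) (k2 : edge_coloring (above X h t)) :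
  (forall x, arcs (below X h t) x -> color_at k x = color_at k1 x) ->
  (forall x, arcs (above X h t) x -> color_at k x = color_at k2 x) ->
  is_tait R k <-> is_tait R k1 /\ is_tait R k2.
Proof.
move=> k1E k2E; rewrite !is_taitP.
have [_ _ [GS _ VG _ _] _ _] := HX.
have [N1 [oN1 XN1 aN1 YN1]] := agree_below.
have [N2 [oN2 XN2 aN2 YN2]] := agree_above.
have t1 v : surf X v -> h v < t -> tait_at R k v <-> tait_at R k1 v.
  by move=> Sv hv; apply: tait_at_agree oN1 aN1 YN1 _ k1E; exact: XN1.
have t2 v : surf X v -> t < h v -> tait_at R k v <-> tait_at R k2 v.
  by move=> Sv hv; apply: tait_at_agree oN2 aN2 YN2 _ k2E; exact: XN2.
have htv v : verts X v -> h v != t.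
  move=> Vv; apply/eqP => hv.
  by have [] := level_generic (GS _ (VG _ Vv)) hv.
split=> [tk|[tk1 tk2] v Vv].
  split=> v [Vv hv].
    by apply/t1; [exact/GS/VG|rewrite lt_neqAle htv|exact: tk].
  by apply/t2; [exact/GS/VG|rewrite lt_neqAle eq_sym htv|exact: tk].
have Sv := GS _ (VG _ Vv); move: (htv v Vv); rewrite neq_lt => /orP[hv|hv].
  by apply/t1 => //; apply: tk1; split=> //; exact: ltW.
by apply/t2 => //; apply: tk2; split=> //; exact: ltW.
Qed.

(** The set [C] is a half-arc ending at [x]. Nothing is claimed about the two halves lying in
    different parts: for gluing it is enough that each lies in one. *)
Lemma cross_arcs x : arcs X x -> h x = t ->
  exists2 W, open_nbhs x W & forall y, W y -> arcs X y ->
  exists C, [/\ connected C, C x, C y &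
    C `<=` arcs (below X h t) \/ C `<=` arcs (above X h t)].
Proof.
move=> [Gx nVx] hx; have Sx := graph_surf Gx.
have [chs _ _ [e [P [U [f [g]]]]]] := Ht.
move=> [[e0 oU] [fU gU fK gK [cf cg]] cE [PC fP UG] UV].
have gS q : (@unit_circle R `*` ([set` `]- e, e[] : set R)) q -> surf X (g q).
  by move=> qM; case: oU gU => W _ -> /(_ q qM)[].
have : circ (cross_section X h t) x by [].
rewrite cE => -[[p r0] [/= pc r00] gx]; subst r0.
have I0 : 0 \in `]-e, e[ by rewrite in_itv /= oppr_lt0 e0.
have Ux : U x by rewrite -gx; apply: gU.
have fx : f x = (p, 0) by rewrite -gx gK // inE.
have Pp : P p.
  have : (U `&` graph X) x by [].
  rewrite UG => -[[q r] [/= Pq rI] gq].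
  by rewrite -[p]/(p, 0 : R).1 -fx -gq gK ?inE //; split=> //=; exact: PC.
(* Removing the finitely many other points of [P] leaves only the arc over [p] in the product
   graph. *)
pose Q : set (R * R * R) := fst @^-1` (~` (P `\ p)).
have oQ : open Q.
  apply: open_comp; first by move=> ? _; exact: cvg_fst.
  apply: closed_openC.
  apply: (accessible_finite_set_closed.1 _ _ (finite_setD _ fP)).
  exact/hausdorff_accessible/norm_hausdorff.
have [W oW WE] : open_in (surf X) (U `&` f @^-1` Q).
  exact: open_in_trans oU (open_in_preimage cf oQ).
exists W.
  split=> //; suff : (surf X `&` W) x by case.
  by rewrite -WE; split=> //; rewrite /Q /= fx => -[].
(* By [cE] a point at level [t] is the image of some [(q, 0)], and [g] is injective on the
   product. *)
have levelE r : r \in `]-e, e[ -> h (g (p, r)) = t -> r = 0.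
  move=> rI hr; have pr : (@unit_circle R `*` [set` `]- e, e[]) (p, r).
    by split=> //; exact: PC.
  have : circ (cross_section X h t) (g (p, r)) by split=> //; exact: gS.
  rewrite cE => -[[q s] [/= qc s0] gq].
  have := gK (p, r); rewrite inE => /(_ pr).
  by rewrite -gq gK ?inE; [case=> _ <-|split=> //=; rewrite s0].
pose gp r := g (p, r).
have cgp : {within [set` `]-e, e[], continuous gp}.
  apply: (@continuous_within_comp _ _ _ _
    (@unit_circle R `*` ([set` `]- e, e[] : set R))) cg.
    by move=> r rI; split=> //; exact: PC.
  apply: continuous_subspaceT.
  by apply: continuous_pair => ?; [exact: cvg_cst|exact: cvg_id].
(* [h] need not be monotone along the product, but it takes the value [t] only
   at the centre, so each half of the arc lies in a single part. *)
have half (i j : interval R) : [set` i] `<=` [set` `]-e, e[] -> 0 \in i ->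
    (forall r, r \in j -> r \in i /\ r != 0) ->
    (forall r, r \in i -> r = 0 \/ r \in j) ->
    [/\ connected (gp @` [set` i]), (gp @` [set` i]) x &
      gp @` [set` i] `<=` arcs (below X h t) \/
      gp @` [set` i] `<=` arcs (above X h t)].
  move=> iI i0 ji ij; split.
  - apply: connected_continuous_connected.
      exact/connected_intervalP/interval_is_interval.
    exact: continuous_subspaceW cgp.
  - by exists 0.
  have Ai r : r \in i -> arcs X (gp r).
    move=> ri; have : (g @` (P `*` [set` `]- e, e[])) (gp r).
      by exists (p, r) => //; split=> //; exact: iI.
    rewrite -UG => -[Ur Gr]; split=> // Vr.
    by suff : set0 (gp r) by []; rewrite -UV; split=> //; left.
  have ch : {within [set` j], continuous (h \o gp)}.
    apply: (@continuous_within_comp _ _ _ _ (surf X)) chs.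
      by move=> r /ji[/iI rI _]; apply: gS; split=> //; exact: PC.
    by apply: continuous_subspaceW cgp => r /ji[/iI].
  have cj : connected [set` j].
    exact/connected_intervalP/interval_is_interval.
  have nt r : r \in j -> (h \o gp) r <> t.
    by move=> /ji[/iI rI r0] /(levelE r rI) /eqP; rewrite (negbTE r0).
  have h0 : h (gp 0) = t by rewrite /gp gx.
  have [le|ge] := connected_avoid (@cj) ch nt; [left|right].
    rewrite arcs_below => _ [r ri <-]; split; first exact: Ai.
    by have [->|/le //] := ij r ri; rewrite /= h0.
  rewrite arcs_above => _ [r ri <-]; split; first exact: Ai.
  by have [->|/ge //] := ij r ri; rewrite /= h0.
move=> y Wy [Gy nVy]; have : (surf X `&` W) y by split=> //; exact: graph_surf.
rewrite -WE => -[Uy Qy]; have : (U `&` graph X) y by [].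
rewrite UG => -[[q r] [/= Pq rI] gy].
have fy : f y = (q, r) by rewrite -gy gK // inE; split=> //; exact: PC.
have qp : q = p by apply: contrapT => qp; apply: Qy; rewrite fy.
(* The sign of [r] selects the half-arc that joins [x] to [y]. *)
rewrite qp in gy; have [r0|r0] := lerP r 0.
  have [||||cC Cx CA] := half `]-e, 0] `]-e, 0[.
  - move=> s; rewrite /= !in_itv /= => /andP[-> s0].
    by rewrite (le_lt_trans s0).
  - by rewrite in_itv /= oppr_lt0 e0 lexx.
  - by move=> s; rewrite !in_itv /= => /andP[-> s0]; rewrite ltW // lt_eqF.
  - move=> s; rewrite !in_itv /= => /andP[-> s0].
    by have [->|s0'] := eqVneq s 0; [left|right; rewrite lt_neqAle s0'].
  exists (gp @` [set` `]-e, 0]]); split=> //; exists r => //.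
  by move: rI; rewrite /= !in_itv /= => /andP[-> _].
have [||||cC Cx CA] := half `[0, e[ `]0, e[.
- move=> s; rewrite /= !in_itv /= => /andP[s0 ->].
  by rewrite andbT (lt_le_trans _ s0) // oppr_lt0.
- by rewrite in_itv /= e0 lexx.
- by move=> s; rewrite !in_itv /= => /andP[s0 ->]; rewrite ltW // gt_eqF.
- move=> s; rewrite !in_itv /= => /andP[s0 ->].
  by have [->|s0'] := eqVneq s 0; [left|right; rewrite lt_neqAle eq_sym s0' s0].
exists (gp @` [set` `[0, e[]); split=> //; exists r => //.
by move: rI; rewrite /= !in_itv /= (ltW r0) => /andP[_ ->].
Qed.

(** A connected set may cross the level many times, so it is not cut into pieces; local constancy is
    checked below, above and on the level. *)
Lemma const_on_connected_cut kappa :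
  const_on_connected (arcs (below X h t)) kappa ->
  const_on_connected (arcs (above X h t)) kappa ->
  const_on_connected (arcs X) kappa.
Proof.
move=> kb ka C cC CA; apply: locally_constant_connected => // x Cx.
have Ax := CA x Cx; have Sx := graph_surf Ax.1.
have [hx|hx|hx] := ltgtP (h x) t.
- have [W [C' [Wx cC' C'A WC']]] := cylinder_arc HX Ax open_below (conj Sx hx).
  exists W => // y Cy Wy; apply: (kb C') => //.
  + by move=> z /C'A[Az [_ hz]]; rewrite arcs_below; split=> //; exact: ltW.
  + by apply: WC'; split=> //; exact: CA.
  + by apply: WC'; split=> //; case: Wx.
- have [W [C' [Wx cC' C'A WC']]] := cylinder_arc HX Ax open_above (conj Sx hx).
  exists W => // y Cy Wy; apply: (ka C') => //.
  + by move=> z /C'A[Az [_ hz]]; rewrite arcs_above; split=> //; exact: ltW.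
  + by apply: WC'; split=> //; exact: CA.
  + by apply: WC'; split=> //; case: Wx.
- have [W Wx WP] := cross_arcs Ax hx; exists W => // y Cy Wy.
  have [C' [cC' C'x C'y [C'b|C'a]]] := WP y Wy (CA _ Cy).
    exact: (kb C').
  exact: (ka C').
Qed.

End CutCylinder.

(** * Restriction, gluing and counting of colorings *)

Theorem lemma5p21 (R : realType) (T : topologicalType) (X : bordism T)
    (h : T -> R) (t : R)
    (HX : is_cylinder R X) (Ht : generic_cross_section X h t)
    (c1 : coloring (src X)) (c2 : coloring (tgt X)) :
  num_tait R X c1 c2 =
  \sum_(c \in [set: coloring (cross_section X h t)])
     (num_tait R (below X h t) c1 c * num_tait R (above X h t) c c2)%N.
Proof.
have [_ [sM tM _ _] [GS _ VG _ VB] _ _] := HX.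
have [_ hs ht _] := Ht.
have nVB x : bdry X x -> ~ verts X x.
  by move=> bx Vx; suff : set0 x by []; rewrite -VB.
(* These inclusions of marks into arcs let every boundary condition be tested pointwise through
   [restricts_toP]. *)
have srcX : marks (src X) `<=` arcs X.
  by rewrite sM => x [Gx sx]; split=> //; apply: nVB; left.
have tgtX : marks (tgt X) `<=` arcs X.
  by rewrite tM => x [Gx tx]; split=> //; apply: nVB; right.
have srcB : marks (src X) `<=` arcs (below X h t).
  rewrite arcs_below => x sx; split; first exact: srcX.
  by apply/ltW/hs; move: sx; rewrite sM => -[].
have tgtA : marks (tgt X) `<=` arcs (above X h t).
  rewrite arcs_above => x tx; split; first exact: tgtX.
  by apply/ltW/ht; move: tx; rewrite tM => -[].
have midX : marks (cross_section X h t) `<=` arcs X `&` [set x | h x = t].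
  by move=> x [Gx [Sx hx]]; do !split=> //; have [] := level_generic Ht Sx hx.
have midB : marks (cross_section X h t) `<=` arcs (below X h t).
  by rewrite arcs_below => x /midX[Ax /= hx]; split; rewrite //= hx.
have midA : marks (cross_section X h t) `<=` arcs (above X h t).
  by rewrite arcs_above => x /midX[Ax /= hx]; split; rewrite //= hx.
have BX : arcs (below X h t) `<=` arcs X by rewrite arcs_below => ? [].
have AX : arcs (above X h t) `<=` arcs X by rewrite arcs_above => ? [].
have constB (k : edge_coloring X) :
    const_on_connected (arcs (below X h t)) (color_at k).
  move=> C cC CB; exact: (@color_at_const _ _ k C cC (subset_trans CB BX)).
have constA (k : edge_coloring X) :
    const_on_connected (arcs (above X h t)) (color_at k).
  move=> C cC CA; exact: (@color_at_const _ _ k C cC (subset_trans CA AX)).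
(* Restriction goes through points, since an edge of a part may be only a piece of an edge of
   [X]. *)
pose resB (k : edge_coloring X) : edge_coloring (below X h t) :=
  coloring_of (color_at k).
pose resA (k : edge_coloring X) : edge_coloring (above X h t) :=
  coloring_of (color_at k).
pose resO (k : edge_coloring X) : coloring (cross_section X h t) :=
  fun p => color_at k (\val p).
have resBE k x : arcs (below X h t) x -> color_at (resB k) x = color_at k x.
  by move=> Bx; apply: color_at_coloring_of.
have resAE k x : arcs (above X h t) x -> color_at (resA k) x = color_at k x.
  by move=> Ax; apply: color_at_coloring_of.
have inM (O : marked_circle T) (p : marks O) : marks O (\val p).
  exact/set_mem/valP.
apply: (card_fiber_product (c := resO) (f1 := resB) (f2 := resA)).
- exact/finite_set_fun/(finite_edges HX).
- move=> k [tk k1 k2].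
  have [tB tA] := (is_tait_cut HX Ht (fun x Bx => esym (resBE k x Bx))
    (fun x Ax => esym (resAE k x Ax))).1 tk.
  split; split=> //.
  + apply/restricts_toP => // p; rewrite resBE; last exact/srcB/inM.
    by move: p; apply/restricts_toP.
  + by apply/restricts_toP => // p; rewrite resBE //; exact/midB/inM.
  + by apply/restricts_toP => // p; rewrite resAE //; exact/midA/inM.
  + apply/restricts_toP => // p; rewrite resAE; last exact/tgtA/inM.
    by move: p; apply/restricts_toP.
(* The two parts cover [arcs X], so a coloring is recovered from its restrictions. *)
- move=> k l _ _ kl1 kl2; apply: edge_coloring_ext => x Ax.
  have [xt|/ltW tx] := lerP (h x) t.
    have Bx : arcs (below X h t) x by rewrite arcs_below.
    by rewrite -(resBE k) // -(resBE l) // kl1.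
  have Bx : arcs (above X h t) x by rewrite arcs_above.
  by rewrite -(resAE k) // -(resAE l) // kl2.
move=> c a b [ta a1 ac] [tb bc b2].
(* At level [t] the color is that of [a]; it equals that of [b], since both restrict to [c]
   there. *)
pose kappa x := if h x <= t then color_at a x else color_at b x.
have kB x : arcs (below X h t) x -> color_at a x = kappa x.
  by rewrite arcs_below => -[_ /= xt]; rewrite /kappa xt.
have kA x : arcs (above X h t) x -> color_at b x = kappa x.
  rewrite arcs_above => -[Ax /= tx]; rewrite /kappa; case: ifPn => // xt.
  have hx : h x = t by apply/le_anti; rewrite xt.
  have Ox : x \in marks (cross_section X h t).
    by rewrite inE; split; [case: Ax|split=> //; case: Ax => /GS].
  pose p : marks (cross_section X h t) := exist _ x Ox.
  transitivity (c p).
    by have /(_ p) := (restricts_toP _ _ midA).1 bc.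
  by have /(_ p) := (restricts_toP _ _ midB).1 ac.
have kX : const_on_connected (arcs X) kappa.
  apply: (const_on_connected_cut HX Ht) => C cC CY x y Cx Cy.
    have := @color_at_const _ _ a C cC CY x y Cx Cy.
    by rewrite !kB //; exact: CY.
  have := @color_at_const _ _ b C cC CY x y Cx Cy.
  by rewrite !kA //; exact: CY.
pose k : edge_coloring X := coloring_of kappa.
have kE x : arcs X x -> color_at k x = kappa x.
  by move=> Ax; apply: color_at_coloring_of.
exists k; split.
- split.
  + have kBE x : arcs (below X h t) x -> color_at k x = color_at a x.
      by move=> Bx; rewrite kE ?kB //; exact: BX.
    have kAE x : arcs (above X h t) x -> color_at k x = color_at b x.
      by move=> Ax; rewrite kE ?kA //; exact: AX.
    exact: (is_tait_cut HX Ht kBE kAE).2 (conj ta tb).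
  + apply/restricts_toP => // p; rewrite kE; last exact/srcX/inM.
    rewrite -kB; last exact/srcB/inM.
    by move: p; apply/restricts_toP.
  + apply/restricts_toP => // p; rewrite kE; last exact/tgtX/inM.
    rewrite -kA; last exact/tgtA/inM.
    by move: p; apply/restricts_toP.
- apply/funext => p; rewrite /resO kE; last by have [] := midX _ (inM _ p).
  rewrite -kB; last exact/midB/inM.
  by move: p; apply/restricts_toP.
- apply: edge_coloring_ext => x Bx; rewrite resBE // kE ?kB //; exact: BX.
- apply: edge_coloring_ext => x Ax; rewrite resAE // kE ?kA //; exact: AX.
Qed.
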